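(* Let $W$ be a binary erasure channel with erasure probability $\epsilon$, where $0<\epsilon<1$, and let $r=2^t$ with $t\ge 1$ an integer. Let $C_{rR}$ be the capacity (per channel use) of the regular polar coded repetition scheme with $r$ repetitions over $W$, and let $\frac{1}{r}C(W^r)=\frac{1-\epsilon^r}{r}$ be the corresponding capacity of the straightforward repetition scheme with $r$ repetitions. Then $$C_{rR} > \frac{C(W^r)}{r},$$ or, equivalently, $$\sum_{k=1}^{r} Z_{P^{(0)}_r}(W^{(k)}_r) < r\,\epsilon .$$
   Context: $C(\cdot)$ denotes channel capacity; for a binary erasure channel $\mathrm{BEC}(\epsilon)$ with erasure probability $\epsilon$, $C=1-\epsilon$. For $W=\mathrm{BEC}(\epsilon)$, the $r$-repetition channel $W^r$ (each input bit is sent $r$ times over $W$) is $\mathrm{BEC}(\epsilon^r)$, so $C(W^r)=1-\epsilon^r$. Let $P_2^{(0)}=\begin{pmatrix}1&0\\1&1\end{pmatrix}$ and $P_2^{(1)}=\begin{pmatrix}1&0\\0&1\end{pmatrix}$. For $r=2^t$ and $i\in\{0,1,\ldots,r-1\}$ with $t$-bit binary expansion $(i_1,\ldots,i_t)$, $i_1$ the most significant bit, the pattern is $P_r^{(i)}=P_2^{(i_1)}\otimes\cdots\otimes P_2^{(i_t)}$; in particular $P^{(0)}_r=(P_2^{(0)})^{\otimes t}$ and $P^{(r-1)}_r=(P_2^{(1)})^{\otimes t}$. The regular polar coded repetition scheme uses the pattern $P^{(0)}_r$ in the first transmission and the pattern $P^{(r-1)}_r$ in the remaining $r-1$ transmissions.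 The erasure probabilities $Z_{P^{(i)}_r}(W^{(k)}_r)=Z_{(i_1,\ldots,i_t)}(W^{(k)}_r)$, $k=1,\ldots,r$, of the channels observed by the $r$ component codewords under the pattern $P^{(i)}_r$ are real numbers defined recursively by $Z(W^{(1)}_1)=\epsilon$ (empty index string, $r=1$) and, for $t\ge1$ and $j=1,\ldots,r/2$, writing $z=Z_{(i_1,\ldots,i_{t-1})}(W^{(j)}_{r/2})$, $$Z_{(i_1,\ldots,i_t)}(W^{(2j-1)}_r)=z\,\bigl[1+z-z^2\bigr]^{1-i_t},\qquad Z_{(i_1,\ldots,i_t)}(W^{(2j)}_r)=z\cdot z^{\,1-i_t}.$$ The capacity of the regular polar coded repetition scheme is $$C_{rR}=\frac{r-\sum_{k=1}^r Z_{P^{(0)}_r}(W^{(k)}_r)\,\bigl(Z_{P^{(r-1)}_r}(W^{(k)}_r)\bigr)^{r-1}}{r^2}.$$ *)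

(* Defs.v *)
From HB Require Import structures.
From mathcomp Require Import all_boot all_order all_algebra.
From mathcomp Require Import all_classical all_reals all_analysis.

Set Implicit Arguments.
Unset Strict Implicit.
Unset Printing Implicit Defensive.

Import Order.TTheory GRing.Theory Num.Theory.

Local Open Scope classical_set_scope.
Local Open Scope ring_scope.

(* A discrete memoryless channel is given by its transition probabilities:
   W x y is the probability of receiving y when x is sent. *)
Definition channel (R : realType) (X Y : finType) := X -> Y -> R.

Definition log2 (R : realType) (x : R) : R := ln x / ln 2.

Definition input_dist (R : realType) (X : finType) : set (X -> R) :=
  [set p | (forall x, 0 <= p x) /\ \sum_x p x = 1].

(* Mutual information, in bits, between the input (of law p) and the output.
   A summand with p x * W x y = 0 vanishes, and otherwise the argument of the
   logarithm is a positive real, so the values of ln and of the division at 0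
   are irrelevant. *)
Definition mutual_info (R : realType) (X Y : finType)
    (p : X -> R) (W : channel R X Y) : R :=
  \sum_x \sum_y p x * W x y * log2 (W x y / \sum_x' p x' * W x' y).

Definition capacity (R : realType) (X Y : finType) (W : channel R X Y) : R :=
  sup [set mutual_info p W | p in @input_dist R X].

(* The output None is the erasure symbol. *)
Definition BEC (R : realType) (eps : R) : channel R bool (option bool) :=
  fun x y => if y is Some b then (if b == x then 1 - eps else 0) else eps.

(* The input is sent r times, with independent uses of W; the receiver
   observes all r outputs. *)
Definition repetition (R : realType) (X Y : finType) (r : nat)
    (W : channel R X Y) : channel R X {ffun 'I_r -> Y} :=
  fun x y => \prod_(m < r) W x (y m).

(* The t-bit expansion (i_1, ..., i_t) of i, most significant bit first. *)
Definition bits (t i : nat) : seq bool :=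
  [seq odd (i %/ 2 ^ (t - m)) | m <- iota 1 t].

(* Zrev eps [:: i_t; ...; i_1] k: the recursion peels off the last bit i_t, so
   the string is read backwards. The channel index k is 1-based: k = 2j - 1 and
   k = 2j both have uphalf k = j. *)
Fixpoint Zrev (R : realType) (eps : R) (s : seq bool) (k : nat) : R :=
  if s is b :: s' then
    let z := Zrev eps s' (uphalf k) in
    if odd k then z * (1 + z - z ^+ 2) ^+ (1 - b) else z * z ^+ (1 - b)
  else eps.

(* Erasure probability of the k-th channel, 1 <= k <= 2 ^ t, under the pattern
   of index i < 2 ^ t; the pattern, a Kronecker product of the 2 x 2 matrices
   selected by the bits of i, enters only through those bits. *)
Definition Zpattern (R : realType) (eps : R) (t i k : nat) : R :=
  Zrev eps (rev (bits t i)) k.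

(* Capacity per channel use of the regular polar coded repetition scheme with
   r = 2 ^ t: pattern 0 once, then pattern r - 1 in r - 1 transmissions. *)
Definition regular_capacity (R : realType) (eps : R) (t : nat) : R :=
  let r := (2 ^ t)%N in
  (r%:R - \sum_(1 <= k < r.+1)
            Zpattern eps t 0 k * Zpattern eps t r.-1 k ^+ r.-1) / r%:R ^+ 2.

(* Main.v *)
Require Import Defs.
From mathcomp Require Import all_boot all_order all_algebra.
From mathcomp Require Import all_classical all_reals all_analysis.
From mathcomp Require Import ring lra.

Set Implicit Arguments.
Unset Strict Implicit.
Unset Printing Implicit Defensive.

Import Order.TTheory GRing.Theory Num.Theory.
Local Open Scope ring_scope.

(** The all-ones pattern leaves every erasure probability equal to [eps], and
    [C(W^r) = 1 - eps ^ r], so both inequalities amount to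
    [\sum_k Z_k < r * eps] for the pattern [0].  One polarization step replaces
    [z] by a pair of sum [z + 2 z^2 - z^3 = 2 z - z (1 - z)^2 < 2 z] and keeps
    both members in [(0, 1)], so the sum less than doubles at each step. *)

Definition entropy (R : realType) (X : finType) (p : X -> R) : R :=
  \sum_x p x * log2 (p x)^-1.

(** The symbol [e] acts as an erasure: it is equally likely under both inputs, so its summands carry
    [log2 1 = 0]. Any other received symbol determines the input, so its logarithm reduces to that
    of [(p x)^-1]. *)
Lemma mutual_info_erasure (R : realType) (Y : finType) (W : channel R bool Y)
    (e : Y) (d : R) (p : bool -> R) :
  (forall x, W x e = d) ->
  (forall x y, y != e -> W x y != 0 -> W (~~ x) y = 0) ->
  (forall x, \sum_y W x y = 1) ->
  input_dist p -> mutual_info p W = (1 - d) * entropy p.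
Proof.
move=> We Wdisj W1 [_ p1]; rewrite /mutual_info /entropy mulr_sumr.
apply: eq_bigr => x _; rewrite (bigD1 e) //= !We.
have -> : \sum_x' p x' * W x' e = d.
  by under eq_bigr do rewrite We; rewrite -mulr_suml p1 mul1r.
have -> : p x * d * log2 (d / d) = 0.
  have [->|d0] := eqVneq d 0; first by rewrite mulr0 mul0r.
  by rewrite divff // /log2 ln1 mul0r mulr0.
(* Read [1 - d] as the mass that row [x] puts on symbols other than [e], then compare symbol by
   symbol. *)
rewrite add0r -(W1 x) [in RHS](bigD1 e) //= We [d + _]addrC addrK mulr_suml.
apply: eq_bigr => y yNe.
have [->|W0] := eqVneq (W x y) 0; first by rewrite mulr0 !mul0r.
have -> : \sum_x' p x' * W x' y = p x * W x y.
  have := Wdisj x y yNe W0.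
  by case: (x) => /= h; rewrite big_bool h mulr0 /= ?addr0 ?add0r.
rewrite invfM [W x y * (_ * _)]mulrCA divff // mulr1.
by rewrite [RHS]mulrCA [RHS]mulrA.
Qed.

Lemma ln2_gt0 (R : realType) : 0 < ln (2 : R).
Proof. by rewrite ln_gt0 // ltr1n. Qed.

Lemma entropy_bool_le1 (R : realType) (p : bool -> R) :
  input_dist p -> entropy p <= 1.
Proof.
move=> [p0 p1]; rewrite /entropy.
(* The right side is the tangent at [1/2] to the concave map [u * log2 u^-1]; the terms in
   [1 / ln 2] cancel over the two inputs. *)
suff H x : p x * log2 (p x)^-1 <= p x + (2^-1 - p x) / ln 2.
  apply: le_trans (ler_sum _ (fun x _ => H x)) _.
  rewrite big_split /= p1 -mulr_suml big_bool /=.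
  move: p1; rewrite big_bool /= => p1.
  have -> : 2^-1 - p true + (2^-1 - p false) = 0 by lra.
  by rewrite mul0r addr0.
have l2 := @ln2_gt0 R.
have [->|px0] := eqVneq (p x) 0.
  by rewrite mul0r add0r subr0 divr_ge0 // ltW.
have px : 0 < p x by rewrite lt0r px0 p0.
(* [ln u <= u - 1] at [u = 1 / (2 p x)] *)
have : ln (1 + ((2 * p x)^-1 - 1)) <= (2 * p x)^-1 - 1.
  by apply: le_ln1Dx; rewrite ltrBrDl subrr invr_gt0 mulr_gt0.
rewrite addrC subrK lnV ?posrE ?mulr_gt0 // lnM ?posrE // => H.
rewrite /log2 lnV ?posrE // -(ler_pM2r l2) mulrDl !mulrA !divfK ?gt_eqF //.
have := ler_wpM2l (ltW px) H.
have -> : p x * ((2 * p x)^-1 - 1) = 2^-1 - p x by field.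
lra.
Qed.

Lemma entropy_bool_uniform (R : realType) :
  entropy (fun _ : bool => 2^-1 : R) = 1.
Proof.
by rewrite /entropy big_bool invrK /log2 divff ?gt_eqF ?ln2_gt0 // !mulr1 /=; lra.
Qed.

(** Mutual information is [1 - d] times an entropy of at most one bit, and the uniform law reaches
    that bit, so the supremum is an attained maximum. *)
Lemma capacity_erasure (R : realType) (Y : finType) (W : channel R bool Y)
    (e : Y) (d : R) :
  d <= 1 ->
  (forall x, W x e = d) ->
  (forall x y, y != e -> W x y != 0 -> W (~~ x) y = 0) ->
  (forall x, \sum_y W x y = 1) ->
  capacity W = 1 - d.
Proof.
move=> d1 We Wdisj W1.
have ubd : ubound [set mutual_info p W | p in @input_dist R bool]%classic (1 - d).
  move=> _ [p hp <-]; rewrite (mutual_info_erasure We Wdisj W1 hp).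
  by rewrite ler_piMr ?subr_ge0 ?entropy_bool_le1.
have unif : [set mutual_info p W | p in @input_dist R bool]%classic (1 - d).
  have hu : input_dist (fun _ : bool => 2^-1 : R).
    by split=> [x|]; rewrite ?invr_ge0 // big_bool /=; lra.
  exists (fun=> 2^-1) => //.
  by rewrite (mutual_info_erasure We Wdisj W1 hu) entropy_bool_uniform mulr1.
apply/le_anti/andP; split; first by apply: ge_sup => //; exists (1 - d).
by apply: ub_le_sup => //; exists (1 - d).
Qed.

(** The word with all [r] symbols erased plays the role of [e]; a single unerased symbol already
    reveals the input bit. *)
Lemma capacity_repetition_BEC (R : realType) (eps : R) (r : nat) :
  0 <= eps <= 1 -> capacity (repetition (r := r) (BEC eps)) = 1 - eps ^+ r.
Proof.
move=> /andP[eps0 eps1].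
apply: (@capacity_erasure _ _ _ [ffun=> None]).
- by rewrite exprn_ile1.
- move=> x; rewrite /repetition; under eq_bigr do rewrite ffunE.
  by rewrite /= prodr_const card_ord.
- move=> x y yNe W0; have [m ym] : exists m, y m != None.
    apply/existsP; apply: contraR yNe; rewrite negb_exists => /forallP yN.
    by apply/eqP/ffunP => m; rewrite ffunE; apply/eqP; rewrite -[_ == _]negbK yN.
  have W1 : BEC eps x (y m) != 0 by move/prodf_neq0: W0; apply.
  rewrite /repetition (bigD1 m) //=; move: W1 ym.
  case: (y m) => [b|] //=; case: (b =P x) => [->|_]; last by rewrite eqxx.
  by case: x {W0}; rewrite mul0r.
(* Distributivity turns the sum over output words into a product of row sums of [BEC eps], each
   equal to 1. *)
- move=> x; rewrite /repetition -(bigA_distr_bigA (fun=> BEC eps x)) big1 // => m _.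
  have big_option (F : option bool -> R) :
      \sum_o F o = F None + (F (Some true) + F (Some false)).
    rewrite (bigD1 None) //= (bigD1 (Some true)) //= (bigD1 (Some false)) //=.
    by rewrite big1 ?addr0 // => -[[]|].
  by rewrite big_option /=; case: x => /=; lra.
Qed.

Lemma bits0 (t : nat) : bits t 0 = nseq t false.
Proof.
rewrite /bits; apply: (@eq_from_nth _ false).
  by rewrite size_map size_iota size_nseq.
rewrite size_map size_iota => m mt.
by rewrite (nth_map 0%N) ?size_iota // nth_nseq mt div0n.
Qed.

Lemma bits_pred (t : nat) : bits t (2 ^ t).-1 = nseq t true.
Proof.
rewrite /bits; apply: (@eq_from_nth _ false).
  by rewrite size_map size_iota size_nseq.
rewrite size_map size_iota => m mt.
rewrite (nth_map 0%N) ?size_iota // nth_iota // nth_nseq mt add1n.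
(* Dividing [2 ^ t - 1] by [2 ^ (t - m.+1)] gives [2 ^ m.+1 - 1], which is odd. *)
have -> : (2 ^ t = 2 ^ m.+1 * 2 ^ (t - m.+1))%N by rewrite -expnD subnKC.
rewrite divn_pred mulnK ?expn_gt0 // dvdn_mull // subn1.
by rewrite -subn1 oddB ?expn_gt0 // oddX.
Qed.

Lemma Zrev_nseq_true (R : realType) (eps : R) (t k : nat) :
  Zrev eps (nseq t true) k = eps.
Proof.
elim: t k => //= t IH k; rewrite !IH !expr0 !mulr1.
by case: ifP.
Qed.

Lemma Zrev_nseq_false_itv (R : realType) (eps : R) (t k : nat) :
  0 < eps < 1 -> 0 < Zrev eps (nseq t false) k < 1.
Proof.
move=> heps; elim: t k => //= t IH k; move: (IH (uphalf k)).
set z := Zrev _ _ _ => /andP[z0 z1]; rewrite subn0 !expr1.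
case: ifP => _; last by apply/andP; split; nra.
apply/andP; split; first by rewrite mulr_gt0 //; nra.
(* This product is [1 - z * (1 + z - z ^+ 2)]. *)
have : 0 < (1 - z) * (1 - z ^+ 2) by rewrite mulr_gt0 ?subr_gt0 ?expr_lt1 // ltW.
lra.
Qed.

Lemma sum_nat_pairs (V : nmodType) (F : nat -> V) (n : nat) :
  \sum_(1 <= k < n.*2.+1) F k = \sum_(1 <= j < n.+1) (F j.*2.-1 + F j.*2).
Proof.
elim: n => [|n IH]; first by rewrite !big_geq.
by rewrite doubleS [LHS]big_nat_recr //= big_nat_recr //= IH
  [RHS]big_nat_recr //= addrA.
Qed.

Lemma sum_Zrev_step (R : realType) (eps : R) (t n : nat) :
  0 < eps < 1 -> (0 < n)%N ->
  \sum_(1 <= k < n.*2.+1) Zrev eps (nseq t.+1 false) k <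
  2 * \sum_(1 <= k < n.+1) Zrev eps (nseq t false) k.
Proof.
move=> heps n0; rewrite sum_nat_pairs mulr_sumr.
apply: ltr_sum_nat => // j /andP[j0 _] /=.
(* [j >= 1] matters: at [j = 0] the truncated predecessor would be 0, which is even. *)
have -> : odd j.*2.-1 by case: j j0 => // j _; rewrite doubleS /= odd_double.
have -> : uphalf j.*2.-1 = j by case: j j0 => // j _; rewrite doubleS /= doubleK.
rewrite odd_double uphalf_double subn0 !expr1.
have /andP[] := @Zrev_nseq_false_itv R eps t j heps.
set z := Zrev _ _ _ => z0 z1.
have : 0 < z * (1 - z) ^+ 2 by rewrite mulr_gt0 // exprn_gt0 // subr_gt0.
lra.
Qed.

Lemma sum_Zrev_lt (R : realType) (eps : R) (t : nat) :
  0 < eps < 1 -> (0 < t)%N ->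
  \sum_(1 <= k < (2 ^ t).+1) Zrev eps (nseq t false) k < (2 ^ t)%:R * eps.
Proof.
(* The induction starts at exponent 1, since at exponent 0 both sides equal [eps]. *)
move=> heps; case: t => // t _; elim: t => [|t IH].
  apply: lt_le_trans (@sum_Zrev_step _ _ 0 1 heps isT) _.
  by rewrite big_nat1.
rewrite expnS mul2n; apply: lt_trans (sum_Zrev_step _ _ _) _ => //.
  by rewrite expn_gt0.
by rewrite -mul2n natrM -mulrA ltr_pM2l.
Qed.

Theorem mainTheorem1 (R : realType) (eps : R) (heps0 : 0 < eps)
    (heps1 : eps < 1) (t r : nat) (ht : (1 <= t)%N) (hr : r = (2 ^ t)%N) :
  regular_capacity eps t > capacity (repetition (r := r) (BEC eps)) / r%:R /\
  (regular_capacity eps t > capacity (repetition (r := r) (BEC eps)) / r%:R <->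
   \sum_(1 <= k < r.+1) Zpattern eps t 0 k < r%:R * eps).
Proof.
have heps : 0 < eps < 1 by rewrite heps0.
have sum_lt : \sum_(1 <= k < r.+1) Zpattern eps t 0 k < r%:R * eps.
  by rewrite /Zpattern bits0 rev_nseq hr sum_Zrev_lt.
(* As an equality of booleans, this yields both the inequality and the equivalence. *)
suff iff_sum : (capacity (repetition (r := r) (BEC eps)) / r%:R
    < regular_capacity eps t)
    = (\sum_(1 <= k < r.+1) Zpattern eps t 0 k < r%:R * eps).
  by rewrite iff_sum.
have r0 : (0 < r)%N by rewrite hr expn_gt0.
have rR0 : 0 < r%:R :> R by rewrite ltr0n.
rewrite capacity_repetition_BEC ?ltW // /regular_capacity /= -hr.
under eq_bigr do rewrite {2}/Zpattern hr bits_pred -hr rev_nseq Zrev_nseq_true.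
rewrite -mulr_suml.
set S := \sum_(_ <= _ < _) _.
rewrite ltr_pdivrMr // expr2 invfM mulrA divfK ?gt_eqF //.
rewrite ltr_pdivlMr // -[in X in X * _](prednK r0) exprS.
have e0 : 0 < eps ^+ r.-1 by rewrite exprn_gt0.
(* With denominators cleared and [eps ^+ r] split as [eps * eps ^+ r.-1], the capacity inequality is
   the bound on [S] multiplied by [eps ^+ r.-1]. *)
rewrite -(ltr_pM2r e0 S); apply/idP/idP; lra.
Qed.
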